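(* Let $H = (V, A, B)$ be a cross-intersecting family. Suppose that $A$ and $B$ both have minimal elements of $E = A \cup B$, i.e. there are $a \in A$ and $b \in B$ such that $a$ and $b$ both have no subedge in $H$ (no edge $e \in A \cup B$ satisfies $e \subsetneq a$, and no edge $e \in A \cup B$ satisfies $e \subsetneq b$). Then $\chi(H) \leq 4$.
   Context: A hypergraph is a pair $(V,E)$ where $V$ is a set of vertices and $E$ is a set of subsets of $V$ (edges). A cross-intersecting family $H = (V, A, B)$ is a hypergraph with vertex set $V$ and edge set $E = A \cup B$ such that every $a \in A$ intersects every $b \in B$, and $A$, $B$ are not empty. A coloring of the vertices is proper if there are no monochromatic edges; the chromatic number $\chi(H)$ is the minimal number of colors that admits a proper coloring.
   Formalization: The formal statement also assumes that every edge has at least two vertices; otherwise H has no proper coloring and its chromatic number is undefined (for example V = {v}, A = B = {{v}}). *)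

(* Defs.v *)
From mathcomp Require Import all_boot.
From mathcomp Require Import boolp classical_sets.

Set Implicit Arguments.
Unset Strict Implicit.
Unset Printing Implicit Defensive.

Local Open Scope classical_set_scope.

(** A hypergraph on the (possibly infinite) vertex type [V] is given by its
    edge set [E : set (set V)]. *)

Definition monochromatic (V C : Type) (c : V -> C) (e : set V) : Prop :=
  forall x y, e x -> e y -> c x = c y.

Definition proper_coloring (V C : Type) (E : set (set V)) (c : V -> C) : Prop :=
  forall e, E e -> ~ monochromatic c e.

Definition colorable (V : Type) (E : set (set V)) (k : nat) : Prop :=
  exists c : V -> 'I_k, proper_coloring E c.

(** [is_chromatic_number E k] reads "chi(H) exists, is finite, and equals [k]".
    It is a relation because some hypergraphs have no finite (or no) proper
    coloring. *)
Definition is_chromatic_number (V : Type) (E : set (set V)) (k : nat) : Prop :=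
  colorable E k /\ forall j, colorable E j -> k <= j.

Definition cross_intersecting (V : Type) (A B : set (set V)) : Prop :=
  [/\ A !=set0, B !=set0 & forall a b, A a -> B b -> a `&` b !=set0].

Definition minimal_edge (V : Type) (E : set (set V)) (e : set V) : Prop :=
  E e /\ ~ exists2 e', E e' & e' `<` e.

Definition nontrivial_edges (V : Type) (E : set (set V)) : Prop :=
  forall e, E e -> exists x y, [/\ e x, e y & x <> y].

(** An edge with at most one vertex is monochromatic under every coloring, so
    having at least two vertices in each edge is exactly what is needed for
    chi(H) to be defined, possibly as an infinite cardinal. *)
Lemma proper_coloring_existsP (V : Type) (E : set (set V)) :
  (exists (C : Type) (c : V -> C), proper_coloring E c) <-> nontrivial_edges E.
Proof.
split=> [[C [c cP]] e Ee | EP].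
- apply: contrapT => eN; apply: (cP e Ee) => x y ex ey.
  have [->//|xy] := pselect (x = y).
  by case: eN; exists x, y.
- exists V, id => e Ee em; have [x [y [ex ey]]] := EP e Ee.
  by apply; apply: em.
Qed.

(* Main.v *)
(** Every edge of [A] meets [b] and every edge of [B] meets [a], so each edge
    meets [a] or [b].  If [a <> b], color a vertex by its membership in [a] and
    in [b]: a monochromatic edge of [A] lies inside [b], so equals [b] by
    minimality and meets [a], so also lies inside [a] and equals [a]; edges of
    [B] are symmetric.  If [a = b], every edge meets [a], and an edge inside
    [a] is [a] itself, so coloring by membership in [a] and singling out one
    vertex of [a] suffices. *)
Require Import Defs.
From mathcomp Require Import all_boot.
From mathcomp Require Import boolp classical_sets.

Local Open Scope classical_set_scope.

Lemma colorable_chromatic_number (V : Type) (E : set (set V)) (n : nat) :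
  colorable E n -> exists2 k, is_chromatic_number E k & k <= n.
Proof.
move=> En.
have exE : exists k, `[< colorable E k >] by exists n; apply/asboolP.
case: (ex_minnP exE) => k /asboolP Ek kmin.
exists k; last by apply: kmin; apply/asboolP.
by split=> // j Ej; apply: kmin; apply/asboolP.
Qed.

Lemma colorable_card (V : Type) (C : finType) (E : set (set V)) (c : V -> C) :
  proper_coloring E c -> colorable E #|C|.
Proof.
move=> cP; exists (enum_rank \o c) => e Ee em; apply: (cP e Ee) => x y ex ey.
exact: enum_rank_inj (em x y ex ey).
Qed.

(** The four colors are the pairs of truth values of [P] and [Q]. One-way implications suffice,
    since [x] and [y] can be exchanged. *)
Lemma colorable_two_sets (V : Type) (E : set (set V)) (P Q : set V) :
  (forall e, E e ->
    ~ forall x y, e x -> e y -> (P x -> P y) /\ (Q x -> Q y)) ->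
  colorable E 4.
Proof.
move=> PQ.
suff cP : proper_coloring E (fun v => (`[< P v >], `[< Q v >])).
  by have := colorable_card _ _ _ _ cP; rewrite card_prod card_bool.
move=> e Ee em; apply: (PQ e Ee) => x y ex ey.
case: (em x y ex ey) => eP eQ.
by split=> /asboolP; rewrite ?eP ?eQ => /asboolP.
Qed.

Lemma minimal_edge_eq (V : Type) (E : set (set V)) (m e : set V) :
  minimal_edge E m -> E e -> e `<=` m -> e = m.
Proof.
move=> [_ mmin] Ee em; apply: contrapT => enm; apply: mmin; exists e => //.
by rewrite properEneq; split=> //; apply/eqP.
Qed.

(** A single common vertex pulls all of [e] into [m], and minimality excludes proper inclusion. *)
Lemma meeting_minimal_edge_eq (V : Type) (E : set (set V)) (m e : set V) :
  minimal_edge E m -> E e -> e `&` m !=set0 ->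
  (forall x y, e x -> e y -> m x -> m y) -> e = m.
Proof.
move=> mmin Ee [x [ex mx]] em; apply: (minimal_edge_eq _ _ _ _ mmin Ee) => y ey.
exact: em mx.
Qed.

Theorem proposition1p4 (V : Type) (A B : set (set V))
    (hAB : cross_intersecting A B)
    (hE : nontrivial_edges (A `|` B))
    (hA : exists2 a, A a & minimal_edge (A `|` B) a)
    (hB : exists2 b, B b & minimal_edge (A `|` B) b) :
  exists2 k, is_chromatic_number (A `|` B) k & k <= 4.
Proof.
apply: colorable_chromatic_number.
case: hAB hA hB => _ _ AB [a Aa amin] [b Bb bmin].
have [ab|anb] := pselect (a = b).
  rewrite -{}ab {b} in Bb bmin.
  have [x [y [ax ay xy]]] := hE a (or_introl Aa).
  apply: (colorable_two_sets _ _ a [set x]) => e Ee em.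
  (* Here [a] lies in both [A] and [B], so either kind of edge meets it. *)
  have ea : e `&` a !=set0 by case: Ee => ?; [|rewrite setIC]; apply: AB.
  have eE : e = a.
    by apply: (meeting_minimal_edge_eq _ _ _ _ amin Ee ea) => u v eu /(em u v eu)[].
  rewrite eE in em.
  (* Equal colors on [a] would put [y] in [[set x]], against [x <> y]. *)
  by have [_ /(_ erefl)/esym] := em x y ax ay.
apply: (colorable_two_sets _ _ a b) => e Ee em.
have to_a : e `&` a !=set0 -> e = a.
  move=> ea.
  by apply: (meeting_minimal_edge_eq _ _ _ _ amin Ee ea) => u v eu /(em u v eu)[].
have to_b : e `&` b !=set0 -> e = b.
  move=> eb.
  by apply: (meeting_minimal_edge_eq _ _ _ _ bmin Ee eb) => u v eu /(em u v eu)[].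
case: (Ee) => [Ae | Be].
- have eb := to_b (AB e b Ae Bb).
  (* As [e] is now [b], it meets [a] by cross-intersection of [a] with [b]. *)
  by apply: anb; rewrite -eb -to_a // eb setIC; apply: AB.
- have ea : e = a by apply: to_a; rewrite setIC; apply: AB.
  by apply: anb; rewrite -ea -to_b // ea; apply: AB.
Qed.
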